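(* Let $H_1,\dots,H_k$ be pairwise commuting real symmetric $d\times d$ matrices, let $\mathfrak{H}=\langle H_1,\dots,H_k\rangle$ be their real linear span, and let $\mathrm{GM}(\mathfrak{H})=\exp(\mathfrak{H})$. Fix a positive definite real symmetric $d\times d$ matrix $\rho$ and let $b_i:=\langle H_i,\rho\rangle=\mathrm{Tr}(H_i\rho)$ for $i=1,\dots,k$. Let $M_\rho$ be the affine linear space $$M_\rho:=\{A\in\mathbb{S}^d_{\mathbb{R}}\mid \langle H_i,A\rangle=b_i\ \text{for } i=1,\dots,k\}.$$ Then $M_\rho\cap \mathrm{GM}(\mathfrak{H})$ consists of a unique point $\rho^*$. The point $\rho^*$ is the maximiser of the von Neumann entropy inside $M_\rho$, and it is the quantum information projection of $\rho$ to $\mathrm{GM}(\mathfrak{H})$.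
   Context: $\mathbb{S}^d_{\mathbb{R}}$ is the space of real symmetric $d\times d$ matrices, with inner product $\langle A,B\rangle=\mathrm{Tr}(AB)$. A Hamiltonian is a real symmetric matrix. For a linear space $\mathcal{L}$ of real symmetric matrices, the Gibbs manifold is $\mathrm{GM}(\mathcal{L})=\{\exp(L)\mid L\in\mathcal{L}\}$, where $\exp$ is the matrix exponential; such a Gibbs manifold is called a quantum exponential family. The von Neumann entropy of a positive semidefinite matrix $\rho$ is $S(\rho)=-\mathrm{Tr}(\rho\log\rho)$. The quantum relative entropy between positive semidefinite $\rho$ and $\sigma$ is $D(\rho\|\sigma)=\mathrm{Tr}(\rho(\log\rho-\log\sigma))$ if $\mathrm{Supp}(\rho)\subseteq\mathrm{Supp}(\sigma)$, and $+\infty$ otherwise, where the support of an operator is the orthogonal complement of its kernel. Logarithms have base two. The quantum information projection of $\rho$ to a quantum exponential family $\mathcal{Q}$ is $\tilde\rho=\mathrm{argmin}_{\rho'\in\mathcal{Q}}D(\rho\|\rho')$.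
   Formalization: The entropy and projection claims are proved assuming the identity lies in the span of the H_i, with the entropy maximum over positive semidefinite points of M_ρ and the projection over points of GM with the same trace as ρ; without these both claims fail in general. *)

(* Defs.v *)
From HB Require Import structures.
From mathcomp Require Import all_boot all_order all_algebra.
From mathcomp Require Import all_classical all_reals all_analysis.

Set Implicit Arguments.
Unset Strict Implicit.
Unset Printing Implicit Defensive.

Import Order.TTheory GRing.Theory Num.Theory numFieldNormedType.Exports.
Local Open Scope classical_set_scope.
Local Open Scope ring_scope.

Definition argmin (T : Type) (o : Order.disp_t) (V : porderType o)
    (f : T -> V) (A : set T) : set T :=
  [set x | A x /\ forall y, A y -> (f x <= f y)%O].

Definition argmax (T : Type) (o : Order.disp_t) (V : porderType o)
    (f : T -> V) (A : set T) : set T :=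
  [set x | A x /\ forall y, A y -> (f y <= f x)%O].

Section QuantumExponentialFamily.
Variables (R : realType) (d : nat).
Implicit Types (A rho sigma : 'M[R]_d) (Q : set 'M[R]_d).

Definition psdmx : set 'M[R]_d :=
  [set A | A \is symmetricmx /\
           forall v : 'cV[R]_d, 0 <= (v^T *m A *m v) 0 0].

Definition pdmx : set 'M[R]_d :=
  [set A | A \is symmetricmx /\
           forall v : 'cV[R]_d, v != 0 -> 0 < (v^T *m A *m v) 0 0].

Definition expmx A : 'M[R]_d :=
  limn (series (fun n : nat => n`!%:R^-1 *: A ^+ n)).

(* Functional calculus: an orthogonal diagonalization A = P^T diag(v) P
   exists for symmetric A, and P^T diag(f(v)) P does not depend on it. *)
Definition spectral_fun (f : R -> R) A : 'M[R]_d :=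
  [get B | exists P : 'M[R]_d, exists v : 'rV[R]_d,
     [/\ P *m P^T = 1%:M,
         A = P^T *m diag_mx v *m P &
         B = P^T *m diag_mx (map_mx f v) *m P]].

(* Since ln 0 = 0, the base-two logarithm vanishes on the kernel of a positive
   semidefinite matrix; this is the usual convention 0 log 0 = 0. *)
Definition log2mx : 'M[R]_d -> 'M[R]_d :=
  spectral_fun (fun x : R => ln x / ln 2).

Definition von_neumann_entropy rho : R := - \tr (rho *m log2mx rho).

Definition support A : set 'cV[R]_d :=
  [set u | forall v : 'cV[R]_d, A *m v = 0 -> u^T *m v = 0].

Definition relative_entropy rho sigma : \bar R :=
  if `[< support rho `<=` support sigma >]
  then (\tr (rho *m (log2mx rho - log2mx sigma)))%:E
  else +oo%E.

Definition gibbs_manifold (L : {vspace 'M[R]_d}) : set 'M[R]_d :=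
  [set expmx A | A in [set A | A \in L]].

(* States are compared at equal trace (trace one for density matrices): over
   unnormalized sigma (and rho != 0), sigma |-> relative_entropy rho sigma decreases under
   sigma |-> c sigma (c > 1), so it has no minimum on a scaling-invariant
   family. *)
Definition information_projection Q rho : set 'M[R]_d :=
  argmin (relative_entropy rho) (Q `&` [set sigma | \tr sigma = \tr rho]).

Definition moment_space (k : nat) (H : k.-tuple 'M[R]_d) rho : set 'M[R]_d :=
  [set A | A \is symmetricmx /\
           forall i : 'I_k, \tr (tnth H i *m A) = \tr (tnth H i *m rho)].

End QuantumExponentialFamily.

(* Main.v *)
Require Import Defs.
From HB Require Import structures.
From mathcomp Require Import all_boot all_order all_algebra.
From mathcomp Require Import all_classical all_reals all_analysis.
From mathcomp Require Import ring lra.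
From mathcomp Require complex.
Import Order.TTheory GRing.Theory Num.Theory numFieldNormedType.Exports.
Local Open Scope classical_set_scope.
Local Open Scope ring_scope.

(** A commuting family of real symmetric matrices is diagonal in one common
    orthonormal basis, so [exp] of the span of the [H_i] is, in that basis, a
    classical exponential family: the vectors [(e^(l_j))_j] with [l] in the
    linear span [L] of the eigenvalue vectors. Writing [r_j > 0] for the diagonal
    entries of [rho] in the basis, the moment equations become
    [sum_j m_j e^(l_j) = sum_j m_j r_j] for all [m] in [L]. These say that
    [l] is a critical point on [L] of the strictly convex function
    [sum_j (e^(l_j) - r_j l_j)], which is coercive because [r_j > 0]; hence it
    has a minimiser (lemma [exponential_family_moment_map_surj]).

    Everything else follows from Klein's inequality
    [Tr (A (log A - log B)) - Tr A + Tr B >= 0], with equality only if [A = B]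
    ([klein_inequality]), together with the fact that any two points [A], [B]
    of the moment space satisfy [Tr (A K) = Tr (B K)] for every [K] in the span
    ([moment_space_span]). Write [rho' = exp K] for the point of the Gibbs
    manifold in the moment space.
    - If [exp L] is another such point, the two Klein gaps between [exp K] and
      [exp L] add up to [Tr ((exp K - exp L) (K - L)) = 0], so both vanish.
    - When the identity lies in the span all points of the moment space have the
      same trace. As [log rho'] is proportional to [K], the gap between [A]
      and [rho'] is then [S(rho') - S(A)], up to the factor [ln 2].
    - For [sigma = exp L] of the same trace as [rho], the same exchange of [rho]
      for [rho'] gives the Pythagorean identity
      [D(rho || sigma) = D(rho || rho') + D(rho' || sigma)]. *)

(** * Simultaneous orthogonal diagonalization of real symmetric matrices *)

Lemma symmetricmxP {R : fieldType} {n} {A : 'M[R]_n} :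
  reflect (A^T = A) (A \is symmetricmx).
Proof.
rewrite is_hermitianmxE expr0 scale1r map_mx_id // eq_sym; exact: eqP.
Qed.

Lemma dotrv_ge0 {R : realDomainType} n (u : 'rV[R]_n) : 0 <= (u *m u^T) 0 0.
Proof. by rewrite mxE sumr_ge0 // => i _; rewrite mxE -expr2 sqr_ge0. Qed.

Lemma dotrv_eq0 {R : realDomainType} n (u : 'rV[R]_n) :
  ((u *m u^T) 0 0 == 0) = (u == 0).
Proof.
apply/idP/eqP => [|->]; last by rewrite mul0mx mxE.
rewrite mxE psumr_eq0 => [/allP u0|i _]; last by rewrite mxE -expr2 sqr_ge0.
apply/rowP => i; have /implyP/(_ isT) := u0 i (mem_index_enum _).
by rewrite !mxE -expr2 sqrf_eq0 => /eqP.
Qed.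

Section CommonEigenvector.
Import complex.

Lemma map_Re_mulmx {R : rcfType} m n p (v : 'M[R[i]]_(m, n)) (A : 'M[R]_(n, p)) :
  map_mx (@Re R) (v *m map_mx (real_complex R) A) = map_mx (@Re R) v *m A.
Proof.
apply/matrixP => i j; rewrite !mxE.
rewrite (big_morph (@Re R) (id1 := 0) (op1 := +%R)) //.
  by apply: eq_bigr => l _; rewrite !mxE; case: (v i l) => a b /=; ring.
by move=> [a b] [c e].
Qed.

Lemma map_Im_mulmx {R : rcfType} m n p (v : 'M[R[i]]_(m, n)) (A : 'M[R]_(n, p)) :
  map_mx (@Im R) (v *m map_mx (real_complex R) A) = map_mx (@Im R) v *m A.
Proof.
apply/matrixP => i j; rewrite !mxE.
rewrite (big_morph (@Im R) (id1 := 0) (op1 := +%R)) //.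
  by apply: eq_bigr => l _; rewrite !mxE; case: (v i l) => a b /=; ring.
by move=> [a b] [c e].
Qed.

(** A complex common eigenvector [x + iy] has, for each symmetric [A], a real
    eigenvalue: if [a + ib] is the eigenvalue, comparing [x A y^T] with
    [y A x^T] gives [b (x x^T + y y^T) = 0]. Hence [x] and [y] are both
    eigenvectors, and at least one of them is nonzero. *)
Lemma symmetricmx_common_eigenvector {R : rcfType} {n} {As : seq 'M[R]_n} :
  (0 < n)%N -> {in As, forall A, A \is symmetricmx} ->
  {in As &, forall A B, comm_mx A B} ->
  exists2 u : 'rV[R]_n, u != 0 & {in As, forall A, exists a, u *m A = a *: u}.
Proof.
move=> n_gt0 Asym Acomm.
have [|v v_neq0 /allP vP] :=
    @common_eigenvector R[i] n [seq map_mx (real_complex R) A | A <- As] n_gt0.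
  move=> _ _ /mapP[A AAs ->] /mapP[B BAs ->].
  by rewrite /comm_mx -!map_mxM Acomm.
pose x := map_mx (@Re R) v; pose y := map_mx (@Im R) v.
have eigen A : A \in As -> exists a, x *m A = a *: x /\ y *m A = a *: y.
  move=> AAs; have /sub_rVP[[a b] vA] := vP _ (map_f _ AAs).
  have xA : x *m A = a *: x - b *: y.
    by rewrite -map_Re_mulmx vA; apply/rowP => i; rewrite !mxE; case: (v 0 i).
  have yA : y *m A = b *: x + a *: y.
    rewrite -map_Im_mulmx vA; apply/rowP => i; rewrite !mxE; case: (v 0 i) => /=.
    by move=> ? ?; rewrite addrC.
  exists a; suff b0 : b = 0 by rewrite xA yA b0 !scale0r subr0 add0r.
  pose dot (u w : 'rV[R]_n) := (u *m w^T) 0 0.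
  have dotC u w : dot u w = dot w u.
    by rewrite /dot !mxE; apply: eq_bigr => i _; rewrite !mxE mulrC.
  have adj : dot (x *m A) y = dot (y *m A) x.
    rewrite [RHS]dotC /dot trmx_mul mulmxA; congr ((_ *m _ *m _) _ _).
    by rewrite (symmetricmxP (Asym _ AAs)).
  have : b * (dot x x + dot y y) = 0.
    have dotE c1 c2 u1 u2 w : dot (c1 *: u1 + c2 *: u2) w =
        c1 * dot u1 w + c2 * dot u2 w.
      by rewrite /dot mulmxDl -!scalemxAl mxE; congr (_ + _); rewrite [LHS]mxE.
    by move: adj; rewrite xA yA -scaleNr !dotE (dotC y x); lra.
  move/eqP; rewrite mulf_eq0 => /orP[/eqP //|].
  rewrite paddr_eq0 ?dotrv_ge0 // !dotrv_eq0 => /andP[/eqP x0 /eqP y0].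
  case/eqP: v_neq0; apply/rowP => i.
  move/rowP/(_ i): x0; move/rowP/(_ i): y0; rewrite !mxE.
  by case: (v 0 i) => ? ? /= -> ->.
have [x0|x_neq0] := eqVneq x 0; last first.
  by exists x => // A /eigen[a [xA _]]; exists a.
exists y; last by move=> A /eigen[a [_ yA]]; exists a.
apply: contraNneq v_neq0 => y0; apply/eqP/rowP => i.
move/rowP/(_ i): x0; move/rowP/(_ i): y0; rewrite !mxE.
by case: (v 0 i) => ? ? /= -> ->.
Qed.
End CommonEigenvector.


(** The Householder reflection exchanging [u] with the first basis vector [e];
    it degenerates to the identity when [u = e]. *)
Lemma unit_row_completion {R : realFieldType} {n} {u : 'rV[R]_n.+1} :
  (u *m u^T) 0 0 = 1 ->
  exists Q : 'M[R]_n.+1, Q *m Q^T = 1%:M /\ row 0 Q = u.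
Proof.
move=> u1; pose e : 'rV[R]_n.+1 := delta_mx 0 0; pose w := e - u.
have [w0|w_neq0] := eqVneq w 0.
  exists 1%:M; rewrite trmx1 mulmx1 row1; split=> //.
  by move/eqP: w0; rewrite subr_eq0 => /eqP.
have eV (v : 'rV_n.+1) : e *m v^T = (v 0 0)%:M.
  by rewrite -rowE [LHS]mx11_scalar !mxE.
have eu : (u *m e^T) = (u 0 0)%:M.
  by rewrite -[LHS]trmxK trmx_mul trmxK eV tr_scalar_mx.
have ww : w *m w^T = (2 * (1 - u 0 0))%:M.
  rewrite linearB /= mulmxBl !mulmxBr eu !eV [u *m u^T]mx11_scalar u1.
  rewrite -!(rmorphB (@scalar_mx R 1)) /=; congr _%:M.
  by rewrite !mxE !eqxx /=; ring.
have ww_neq0 : 1 - u 0 0 != 0.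
  apply: contraNneq w_neq0 => k0.
  by rewrite -dotrv_eq0 ww k0 mulr0 mxE mul0rn.
pose Q := 1%:M - (1 - u 0 0)^-1 *: (w^T *m w).
have QT : Q^T = Q by rewrite linearB /= linearZ /= trmx_mul trmxK trmx1.
have MM : (w^T *m w) *m (w^T *m w) = (2 * (1 - u 0 0)) *: (w^T *m w).
  by rewrite mulmxA -(mulmxA w^T) ww mul_mx_scalar -scalemxAl.
exists Q; rewrite QT; split.
  rewrite mulmxBl mul1mx mulmxBr mulmx1 -scalemxAl -scalemxAr MM.
  by apply/matrixP => i j; rewrite !mxE; field.
rewrite rowE -/e mulmxBr mulmx1 -scalemxAr mulmxA eV mul_scalar_mx scalerA.
by rewrite !mxE !eqxx mulVf // scale1r subKr.
Qed.

(** Induction on the size: completing a common unit eigenvector to an orthogonal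
    matrix splits every member of the family into a 1x1 block and a smaller
    symmetric block, and the smaller blocks still commute. *)
Lemma symmetricmx_codiagonalizable {R : rcfType} {n} {As : seq 'M[R]_n} :
  {in As, forall A, A \is symmetricmx} ->
  {in As &, forall A B, comm_mx A B} ->
  exists2 P : 'M[R]_n, P *m P^T = 1%:M &
    {in As, forall A, exists v, A = P^T *m diag_mx v *m P}.
Proof.
elim: n As => [|n IHn] As Asym Acomm.
  exists 1%:M => [|A _]; first by rewrite trmx1 mulmx1.
  by exists 0; apply/matrixP => -[].
have [v v_neq0 eigen_v] := symmetricmx_common_eigenvector (ltn0Sn n) Asym Acomm.
have vv_gt0 : 0 < (v *m v^T) 0 0 by rewrite lt_def dotrv_eq0 v_neq0 dotrv_ge0.
pose u := (Num.sqrt ((v *m v^T) 0 0))^-1 *: v.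
have u1 : (u *m u^T) 0 0 = 1.
  rewrite /u linearZ /= -scalemxAl -scalemxAr scalerA mxE -invfM -expr2.
  by rewrite sqr_sqrtr ?ltW // mulVf ?gt_eqF.
have eigen_u A : A \in As -> exists a, u *m A = a *: u.
  move=> /eigen_v[a vA]; exists a.
  by rewrite /u -scalemxAl vA !scalerA mulrC.
have [Q [QQT Qu]] := unit_row_completion u1.
have QTQ : Q^T *m Q = 1%:M by exact: mulmx1C.
pose conj A : 'M[R]_(1 + n) := Q *m A *m Q^T.
have conjT A : A \in As -> (conj A)^T = conj A.
  by move=> /Asym/symmetricmxP AT; rewrite /conj !trmx_mul trmxK AT mulmxA.
have conjM A B : conj A *m conj B = conj (A *m B).
  by rewrite /conj !mulmxA -(mulmxA _ Q^T) QTQ mulmx1.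
have conjE A : A \in As ->
    exists a : 'M[R]_1, conj A = block_mx a 0 0 (drsubmx (conj A)).
  move=> AAs; have [a uA] := eigen_u _ AAs.
  have row0 j : conj A 0 j = (a *: (1%:M : 'M[R]_n.+1)) 0 j.
    have -> : conj A 0 j = row 0 (conj A) 0 j by rewrite !mxE.
    by rewrite /conj !row_mul Qu uA -scalemxAl -Qu -row_mul QQT !mxE.
  have ur0 : ursubmx (conj A) = 0.
    have urE (M : 'M[R]_(1 + n)) j : ursubmx M 0 j = M 0 (lift 0 j).
      by rewrite !mxE lshift0; congr (M _ _); apply: val_inj.
    by apply/rowP => j; rewrite urE row0 !mxE mulr0.
  exists (ulsubmx (conj A)); rewrite -[LHS]submxK ur0; congr block_mx.
  by rewrite -[dlsubmx _]trmxK trmx_dlsub conjT // ur0 trmx0.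
have [_ /mapP[A AAs ->]||P' PP' diagP'] := IHn [seq drsubmx (conj A) | A <- As].
- apply/symmetricmxP; by rewrite trmx_drsub conjT.
- move=> _ _ /mapP[A AAs ->] /mapP[B BAs ->].
  have [a Ea] := conjE _ AAs; have [b Eb] := conjE _ BAs.
  have : conj A *m conj B = conj B *m conj A by rewrite !conjM Acomm.
  rewrite Ea Eb !mulmx_block => /(congr1 drsubmx).
  by rewrite !block_mxKdr !mul0mx !add0r.
pose P0 : 'M[R]_(1 + n) := block_mx 1%:M 0 0 P'.
have PP0 : P0 *m P0^T = 1%:M.
  rewrite tr_block_mx mulmx_block !trmx0 trmx1 !mul0mx !mulmx0 mulmx1 PP'.
  by rewrite !addr0 add0r -scalar_mx_block.
exists (P0 *m Q : 'M[R]_n.+1).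
  by rewrite trmx_mul mulmxA -(mulmxA P0) QQT mulmx1.
move=> A AAs; have [a Ea] := conjE _ AAs.
have [w wE] := diagP' _ (map_f _ AAs).
pose d : 'rV[R]_(1 + n) := row_mx (a 0 0)%:M w.
have EB : conj A = P0^T *m diag_mx d *m P0.
  rewrite Ea wE diag_mx_row tr_block_mx !mulmx_block !trmx0 trmx1.
  rewrite !mul0mx !mulmx0 !mul1mx !mulmx1 !addr0 !add0r.
  congr block_mx; rewrite ?mul0mx //.
  by apply/matrixP => i j; rewrite !ord1 !mxE eqxx.
exists d.
have EA : A = Q^T *m conj A *m Q.
  by rewrite /conj !mulmxA QTQ mul1mx -mulmxA QTQ mulmx1.
by rewrite [LHS]EA EB trmx_mul !mulmxA.
Qed.

(** * The classical case: moments of an exponential family *)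

Section ExponentialFamily.
Variable R : realType.

(** Coercivity in one variable. For [y >= 0] it is the square of
    [1 + y/2 <= e^(y/2)], as [(1 + y/2)^2 - 2y = (1 - y/2)^2]. *)
Lemma ge_expR_addnorm (y : R) : y + `|y| <= expR y.
Proof.
case: (leP 0 y) => y0; last by rewrite ltr0_norm // subrr expR_ge0.
rewrite ger0_norm //.
have -> : expR y = expR (y / 2) ^+ 2 by rewrite expr2 -expRD; congr expR; lra.
have := expR_ge1Dx (y / 2) => h.
have : (1 + y / 2) ^+ 2 <= expR (y / 2) ^+ 2.
  by rewrite ler_pXn2r ?nnegrE ?expR_ge0 //; lra.
apply: le_trans; rewrite -subr_ge0.
have -> : (1 + y / 2) ^+ 2 - (y + y) = (1 - y / 2) ^+ 2 by field.
exact: sqr_ge0.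
Qed.

Lemma expR_sub_linear_lower_bound (r x : R) : 0 < r ->
  r * `|x - ln r| <= expR x - r * x + r * ln r.
Proof.
move=> r0; have := ge_expR_addnorm (x - ln r).
rewrite expRD expRN lnK ?posrE // ler_pdivlMr // mulrC mulrDr => h; lra.
Qed.

(** The function [f] below is minimised over the row space of [B]: its sublevel
    set at the value [f 0] is closed and lies in a box, so it is compact. At the
    minimiser the derivative of [f] along any direction [m] vanishes. *)
Lemma exponential_family_moment_map_surj {d k} (B : 'M[R]_(k, d))
    (r : 'rV[R]_d) :
  (forall j, 0 < r 0 j) ->
  exists l : 'rV[R]_d, (l <= B)%MS /\ forall m : 'rV[R]_d, (m <= B)%MS ->
    \sum_j m 0 j * expR (l 0 j) = \sum_j m 0 j * r 0 j.
Proof.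
move=> r_gt0.
pose f (l : 'rV[R]_d) := \sum_j (expR (l 0 j) - r 0 j * l 0 j).
have cont_f : continuous f.
  apply: continuous_big => [|j _ l]; first exact: add_continuous.
  have cj : {for l, continuous (fun u : 'rV[R]_d => u 0 j)}.
    exact: coord_continuous.
  have ej : {for l, continuous (expR \o (fun u : 'rV[R]_d => u 0 j))}.
    exact: (continuous_comp cj (@continuous_expR _ _)).
  have rj : {for l, continuous (fun _ : 'rV[R]_d => r 0 j)}.
    exact: cst_continuous.
  exact: (continuousB ej (continuousM rj cj)).
have cont_mul j : continuous (fun l : 'rV[R]_d => (l *m cokermx B) 0 j).
  have -> : (fun l : 'rV[R]_d => (l *m cokermx B) 0 j) =
      (fun l => \sum_i l 0 i * cokermx B i j).
    by apply/funext => l; rewrite mxE.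
  apply: continuous_big => [|i _ l]; first exact: add_continuous.
  have ci : {for l, continuous (fun u : 'rV[R]_d => u 0 i)}.
    exact: coord_continuous.
  have Ci : {for l, continuous (fun _ : 'rV[R]_d => cokermx B i j)}.
    exact: cst_continuous.
  exact: (continuousM ci Ci).
(* Adding [r_j ln r_j] makes every summand of [f] nonnegative, so each of them
   is at most [C] on the sublevel set. *)
pose C := f 0 + \sum_j r 0 j * ln (r 0 j).
pose K := [set l : 'rV[R]_d | (l <= B)%MS /\ f l <= f 0].
pose box := [set l : 'rV[R]_d | forall j,
  `[ln (r 0 j) - C / r 0 j, ln (r 0 j) + C / r 0 j]%classic (l 0 j)].
have K_box : K `<=` box.
  move=> l [_ fl] j; suff : `|l 0 j - ln (r 0 j)| <= C / r 0 j.
    by rewrite ler_norml /= in_itv /= => /andP[? ?]; apply/andP; split; lra.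
  rewrite ler_pdivlMr // mulrC.
  apply: (@le_trans _ _ (f l + \sum_j r 0 j * ln (r 0 j))); last first.
    by rewrite lerD2r.
  rewrite -big_split /= (bigD1 j) //=.
  apply: (le_trans (expR_sub_linear_lower_bound _ _ (r_gt0 j))).
  rewrite lerDl sumr_ge0 // => i _.
  apply: le_trans (expR_sub_linear_lower_bound _ _ (r_gt0 i)).
  by rewrite mulr_ge0 // ltW.
have closed_K : closed K.
  have -> : K = \bigcap_(j in setT)
        ((fun l : 'rV[R]_d => (l *m cokermx B) 0 j) @^-1` [set x | x = 0])
      `&` f @^-1` [set x | x <= f 0].
    apply/seteqP; split=> l /=.
      move=> [lB fl]; split=> // j _ /=; move: lB.
      by rewrite submxE => /eqP ->; rewrite mxE.
    move=> [lB fl]; split=> //; rewrite submxE; apply/eqP/rowP => j.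
    by rewrite [RHS]mxE; exact: (lB j).
  apply: closedI.
    apply: closed_bigI => j _; apply: preimage_closed; last exact: closed_eq.
    by move=> l _; exact: cont_mul.
  apply: preimage_closed; last exact: closed_le.
  by move=> l _; exact: cont_f.
have compact_K : compact K.
  apply: (subclosed_compact closed_K _ K_box).
  have seg_compact j :
      compact `[ln (r 0 j) - C / r 0 j, ln (r 0 j) + C / r 0 j].
    exact: segment_compact.
  exact: (rV_compact seg_compact).
have [|l] := compact_EVT_min _ compact_K (continuous_subspaceT cont_f).
  by exists 0; split; rewrite ?sub0mx.
rewrite inE => -[lB fl0] f_min.
have {}f_min t : (t <= B)%MS -> f l <= f t.
  move=> tB; have [t0|t0] := leP (f t) (f 0).
    by apply: f_min; rewrite inE.
  by rewrite (le_trans fl0) // ltW.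
exists l; split=> // m mB.
pose h j (s : R) := expR (l 0 j + s * m 0 j) - r 0 j * (l 0 j + s * m 0 j).
have dh (s : R) (j : 'I_d) : is_derive s (1 : R) (h j)
    (m 0 j * expR (l 0 j + s * m 0 j) - r 0 j * m 0 j).
  rewrite /h.
  have d1 : is_derive s (1 : R) (fun s => l 0 j + s * m 0 j) (m 0 j).
    by apply: is_derive_eq; rewrite scaler0 add0r /GRing.scale /=; ring.
  have d2 := @is_derive1_comp _ expR (fun s => l 0 j + s * m 0 j) _ _ _
    (is_derive_expR _) d1.
  have d3 := is_deriveZ (r 0 j) d1.
  apply: (is_derive_eq (is_deriveB d2 d3)).
  by rewrite /GRing.scale /=; ring.
have hE s : (\sum_j h j) s = f (l + s *: m).
  by rewrite fct_sumE; apply: eq_bigr => j _; rewrite !mxE.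
have : is_derive (0 : R) (1 : R) (\sum_j h j) 0.
  apply: (@derive1_at_min _ _ (-1) 1); rewrite ?in_itv /=; try lra.
    by move=> t _; exact: ex_derive.
  move=> t _; rewrite !hE scale0r addr0; apply: f_min.
  by rewrite addmx_sub // scalemx_sub.
move=> [_ dh0]; have [_] := is_derive_sum (dh 0).
rewrite dh0 => /esym/eqP; rewrite sumrB subr_eq0 => /eqP E.
transitivity (\sum_j m 0 j * expR (l 0 j + 0 * m 0 j)).
  by apply: eq_bigr => j _; rewrite mul0r addr0.
by rewrite E; apply: eq_bigr => j _; rewrite mulrC.
Qed.
End ExponentialFamily.

(** * Functional calculus in an orthonormal eigenbasis *)

Section RotatedDiagonal.
Context {R : realType} {d : nat}.
Implicit Types (P Q : 'M[R]_d) (a v w : 'rV[R]_d).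

Definition rotated_diag P v : 'M[R]_d := P^T *m diag_mx v *m P.

Lemma rotated_diagD P v w :
  rotated_diag P (v + w) = rotated_diag P v + rotated_diag P w.
Proof. by rewrite /rotated_diag linearD mulmxDr mulmxDl. Qed.

Lemma rotated_diagZ P (c : R) v :
  rotated_diag P (c *: v) = c *: rotated_diag P v.
Proof. by rewrite /rotated_diag linearZ -scalemxAr -scalemxAl. Qed.

Lemma rotated_diag_const1 P : P *m P^T = 1%:M ->
  rotated_diag P (const_mx 1) = 1%:M.
Proof. by rewrite /rotated_diag diag_const_mx mulmx1 => /mulmx1C. Qed.

Lemma rotated_diagE P v i j :
  rotated_diag P v i j = \sum_k P k i * v 0 k * P k j.
Proof.
rewrite mxE; apply: eq_bigr => k _; rewrite mul_mx_diag !mxE //.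
Qed.

Lemma rotated_diag_symmetric P v : rotated_diag P v \is symmetricmx.
Proof.
by apply/symmetricmxP; rewrite /rotated_diag !trmx_mul trmxK tr_diag_mx mulmxA.
Qed.

Lemma rotated_diagM P v w : P *m P^T = 1%:M ->
  rotated_diag P v *m rotated_diag P w =
  rotated_diag P (\row_j (v 0 j * w 0 j)).
Proof.
move=> PP; rewrite /rotated_diag !mulmxA -(mulmxA _ P) PP mulmx1.
by rewrite -(mulmxA P^T) mulmx_diag.
Qed.

Lemma rotated_diag_exp P v n : P *m P^T = 1%:M ->
  rotated_diag P v ^+ n = rotated_diag P (map_mx (fun x => x ^+ n) v).
Proof.
move=> PP; elim: n => [|n IHn].
  rewrite expr0 (_ : map_mx _ v = const_mx 1) ?rotated_diag_const1 //.
  by apply/rowP => j; rewrite !mxE expr0.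
rewrite exprS IHn [LHS]rotated_diagM //; congr rotated_diag.
by apply/rowP => j; rewrite !mxE exprS.
Qed.

(** Two orthogonal diagonalizations give the same matrix iff the transition
    matrix [Q P^T] only links equal eigenvalues. This form makes it clear that
    applying a function to the eigenvalues preserves the equality. *)
Lemma eq_rotated_diagP P Q v w : P *m P^T = 1%:M -> Q *m Q^T = 1%:M ->
  (rotated_diag P v = rotated_diag Q w <->
   forall i j, (Q *m P^T) i j * v 0 j = w 0 i * (Q *m P^T) i j).
Proof.
move=> PP QQ.
have twine : Q *m (rotated_diag P v) *m P^T = Q *m P^T *m diag_mx v.
  by rewrite /rotated_diag !mulmxA -(mulmxA _ P) PP mulmx1.
have twine' : Q *m (rotated_diag Q w) *m P^T = diag_mx w *m (Q *m P^T).
  by rewrite /rotated_diag !mulmxA QQ mul1mx.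
split=> [E i j|E].
  have : (Q *m P^T *m diag_mx v) i j = (diag_mx w *m (Q *m P^T)) i j.
    by rewrite -twine // E twine'.
  by rewrite mul_mx_diag mul_diag_mx !mxE.
have {}E : Q *m P^T *m diag_mx v = diag_mx w *m (Q *m P^T).
  by apply/matrixP => i j; rewrite mul_mx_diag mul_diag_mx mxE [RHS]mxE.
have -> : rotated_diag P v = Q^T *m (Q *m rotated_diag P v *m P^T) *m P.
  by rewrite !mulmxA (mulmx1C QQ) mul1mx -mulmxA (mulmx1C PP) mulmx1.
by rewrite twine E /rotated_diag !mulmxA -(mulmxA _ P^T) (mulmx1C PP) mulmx1.
Qed.

Lemma spectral_fun_rotated_diag (f : R -> R) P v : P *m P^T = 1%:M ->
  spectral_fun f (rotated_diag P v) = rotated_diag P (map_mx f v).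
Proof.
move=> PP; apply: get_unique => [|B [Q [w [QQ /eq_rotated_diagP E ->]]]].
  by exists P, v.
symmetry; apply/(eq_rotated_diagP _ _ _ _ PP QQ) => i j.
rewrite [map_mx f v 0 j]mxE [map_mx f w 0 i]mxE.
have := E PP QQ i j; set u := (_ *m _) i j.
have [->|u0] := eqVneq u 0; first by rewrite !mul0r !mulr0.
by rewrite mulrC => /(mulIf u0) ->; rewrite mulrC.
Qed.

Lemma cvg_mx_entries (T : Type) (F : set_system T) m n
    (M : T -> 'M[R]_(m, n)) (L : 'M[R]_(m, n)) : Filter F ->
  (forall i j, (fun t => M t i j) @ F --> L i j) -> M @ F --> L.
Proof.
move=> FF cvgM A [B nbhsB subA].
have : \forall t \near F, forall i j, B i j (M t i j).
  apply: filter_forall => i; apply: filter_forall => j.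
  exact: cvgM (nbhsB i j).
by apply: filterS => t Bt; exact: subA.
Qed.

Lemma expmx_rotated_diag P v : P *m P^T = 1%:M ->
  expmx (rotated_diag P v) = rotated_diag P (map_mx expR v).
Proof.
move=> PP; apply/cvg_lim; first exact: norm_hausdorff.
have -> : series (fun n : nat => n`!%:R^-1 *: rotated_diag P v ^+ n) =
    (fun N => rotated_diag P (map_mx (fun x => series (exp_coeff x) N) v)).
  apply/funext => N; rewrite /series /=.
  elim: N => [|N IHN].
    rewrite big_nil; apply/matrixP => i j; rewrite rotated_diagE big1 ?mxE //.
    by move=> k _; rewrite !mxE big_nil mulr0 mul0r.
  rewrite big_nat_recr //= IHN rotated_diag_exp // -rotated_diagZ.
  rewrite -rotated_diagD; congr rotated_diag; apply/rowP => j.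
  by rewrite !mxE big_nat_recr //= exp_coeffE mulrC.
apply: cvg_mx_entries => i j; rewrite rotated_diagE.
under eq_fun do rewrite rotated_diagE.
apply: cvg_big => [|k _]; first exact: add_continuous.
apply: cvgM; last exact: cvg_cst.
apply: cvgM; first exact: cvg_cst.
under eq_fun do rewrite mxE.
by rewrite mxE; exact: is_cvg_series_exp_coeff.
Qed.

(** The squared entries of the orthogonal matrix [Q P^T] are transition weights,
    so traces of products reduce to weighted sums over pairs of eigenvalues. *)
Lemma mxtrace_rotated_diagM P Q v w :
  \tr (rotated_diag Q v *m rotated_diag P w) =
  \sum_i \sum_j ((Q *m P^T) i j) ^+ 2 * (v 0 i * w 0 j).
Proof.
rewrite /rotated_diag -!mulmxA mxtrace_mulC -!mulmxA.
have -> : P *m Q^T = (Q *m P^T)^T by rewrite trmx_mul trmxK.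
rewrite !mulmxA -(mulmxA _ Q) -!(mulmxA (diag_mx v)).
rewrite /mxtrace; apply: eq_bigr => i _.
rewrite mul_diag_mx mxE mxE mulr_sumr; apply: eq_bigr => j _.
by rewrite mul_mx_diag [in LHS]mxE [_^T _ _]mxE expr2; ring.
Qed.

End RotatedDiagonal.

(** * Klein's inequality *)

Section KleinInequality.
Context {R : realType} {d : nat}.
Implicit Types (A B K rho sigma : 'M[R]_d).

Lemma symmetric_spectral A : A \is symmetricmx ->
  exists P : 'M[R]_d, exists2 v, P *m P^T = 1%:M & A = rotated_diag P v.
Proof.
move=> Asym; have [||P PP diagP] := @symmetricmx_codiagonalizable R d [:: A].
- by move=> B; rewrite inE => /eqP ->.
- by move=> B C; rewrite !inE => /eqP -> /eqP ->.
by have [|v ->] := diagP A; [rewrite inE|exists P, v].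
Qed.

Lemma quadratic_form_rotated_diag (P : 'M[R]_d) v (u : 'cV[R]_d) :
  (u^T *m rotated_diag P v *m u) 0 0 = \sum_j v 0 j * (P *m u) j 0 ^+ 2.
Proof.
have -> : u^T *m rotated_diag P v *m u = (P *m u)^T *m (diag_mx v *m (P *m u)).
  by rewrite /rotated_diag trmx_mul !mulmxA.
rewrite mxE; apply: eq_bigr => j _.
by rewrite mul_diag_mx [_^T _ _]mxE [X in _ * X]mxE; ring.
Qed.

Lemma orthogonal_col_neq0 (P : 'M[R]_d) j : P *m P^T = 1%:M ->
  P^T *m delta_mx j 0 != 0 :> 'cV[R]_d.
Proof.
move=> PP; apply/eqP => /(congr1 (mulmx P)); rewrite mulmxA PP mul1mx mulmx0.
by move=> /matrixP/(_ j 0)/eqP; rewrite !mxE !eqxx oner_eq0.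
Qed.

Lemma eigenvalue_rotated_diag (P : 'M[R]_d) v j : P *m P^T = 1%:M ->
  exists2 u : 'cV[R]_d, u != 0 & (u^T *m rotated_diag P v *m u) 0 0 = v 0 j.
Proof.
move=> PP; exists (P^T *m delta_mx j 0).
  exact: orthogonal_col_neq0.
rewrite quadratic_form_rotated_diag mulmxA PP mul1mx (bigD1 j) //= big1.
  by rewrite mxE !eqxx expr1n mulr1 addr0.
by move=> i ij; rewrite mxE (negPf ij) expr0n mulr0.
Qed.

Lemma psdmx_spectral A : psdmx A ->
  exists P : 'M[R]_d, exists2 v, P *m P^T = 1%:M &
    A = rotated_diag P v /\ forall j, 0 <= v 0 j.
Proof.
move=> [/symmetric_spectral[P [v PP ->]] A_ge0]; exists P, v => //; split=> // j.
by have [u _ <-] := eigenvalue_rotated_diag P v j PP; exact: A_ge0.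
Qed.

Lemma pdmx_spectral A : pdmx A ->
  exists P : 'M[R]_d, exists2 v, P *m P^T = 1%:M &
    A = rotated_diag P v /\ forall j, 0 < v 0 j.
Proof.
move=> [/symmetric_spectral[P [v PP ->]] A_gt0]; exists P, v => //; split=> // j.
by have [u u0 <-] := eigenvalue_rotated_diag P v j PP; exact: A_gt0.
Qed.

Lemma pdmx_psdmx A : pdmx A -> psdmx A.
Proof.
move=> [Asym A_gt0]; split=> // v; have [->|v0] := eqVneq v 0.
  by rewrite mulmx0 mxE.
exact: ltW (A_gt0 _ v0).
Qed.

Lemma pdmx_expmx K : K \is symmetricmx -> pdmx (expmx K).
Proof.
move=> /symmetric_spectral[P [v PP ->]]; rewrite expmx_rotated_diag //.
split=> [|u u0]; first exact: rotated_diag_symmetric.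
have Pu0 : P *m u != 0.
  apply: contraNneq u0 => Pu; rewrite -[u]mul1mx -(mulmx1C PP) -mulmxA Pu.
  by rewrite mulmx0.
rewrite quadratic_form_rotated_diag lt_def; apply/andP; split; last first.
  by rewrite sumr_ge0 // => j _; rewrite mulr_ge0 ?sqr_ge0 // mxE expR_ge0.
apply: contraNneq Pu0 => /eqP.
rewrite psumr_eq0 => [/allP E|j _]; last first.
  by rewrite mulr_ge0 ?sqr_ge0 // mxE expR_ge0.
apply/eqP/matrixP => j o; rewrite ord1 [RHS]mxE.
have := E j (mem_index_enum _); rewrite /= mulf_eq0 sqrf_eq0 mxE.
by rewrite gt_eqF ?expR_gt0 //= => /eqP.
Qed.

Lemma ln2_gt0 : 0 < ln (2 : R).
Proof. by rewrite ln_gt0 // ltr1n. Qed.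

Lemma log2mx_expmx K : K \is symmetricmx -> ln 2 *: log2mx (expmx K) = K.
Proof.
move=> /symmetric_spectral[P [v PP ->]]; rewrite expmx_rotated_diag //.
rewrite /log2mx spectral_fun_rotated_diag // -rotated_diagZ; congr rotated_diag.
apply/rowP => j; rewrite !mxE expRK mulrC divfK // gt_eqF //; exact: ln2_gt0.
Qed.

(** With [x = ln s - ln a] this is [a (e^x - 1 - x) >= 0] when [a > 0]. *)
Lemma scalar_relative_entropy_ge0 {a s : R} : 0 <= a -> 0 < s ->
  0 <= a * ln a - a * ln s - a + s ?= iff (a == s).
Proof.
move=> a0 s0; have [->|a_neq0] := eqVneq a 0.
  rewrite !mul0r !subr0 add0r; split; first exact: ltW.
  by [].
have {a_neq0}a_gt0 : 0 < a by rewrite lt_def a_neq0.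
have exp_ratio : a * expR (ln s - ln a) = s.
  by rewrite expRD expRN !lnK ?posrE // mulrC divfK // gt_eqF.
split.
  rewrite -{2}exp_ratio.
  have := expR_ge1Dx (ln s - ln a); rewrite -(ler_pM2l a_gt0); lra.
have [->|a_neq_s] := eqVneq a s; first by apply/eqP; ring.
apply/negbTE; rewrite eq_sym gt_eqF // -{2}exp_ratio.
have : ln s - ln a != 0.
  rewrite subr_eq0 eq_sym; apply: contra a_neq_s => /eqP /ln_inj.
  by rewrite !posrE => /(_ a_gt0 s0) ->.
by move=> /expR_gt1Dx; rewrite -(ltr_pM2l a_gt0); lra.
Qed.

(** [ln 2] times the relative entropy, corrected by the traces: the Bregman
    divergence of [Tr (A ln A)], which is nonnegative without normalization. *)
Definition klein_gap A B : R :=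
  ln 2 * \tr (A *m (log2mx A - log2mx B)) - \tr A + \tr B.

(** In eigenbases of [A] and [B] the gap is the sum, weighted by the squared
    entries of the transition matrix, of scalar relative entropies between
    eigenvalues. If it vanishes, nonzero weights only join equal eigenvalues,
    which forces [A = B]. *)
Lemma klein_inequality A B : psdmx A -> pdmx B ->
  0 <= klein_gap A B ?= iff (A == B).
Proof.
move=> /psdmx_spectral[Q [a QQ [-> a_ge0]]] /pdmx_spectral[P [s PP [-> s_gt0]]].
pose U i j := (Q *m P^T) i j.
pose gap i j := a 0 i * ln (a 0 i) - a 0 i * ln (s 0 j) - a 0 i + s 0 j.
have -> : klein_gap (rotated_diag Q a) (rotated_diag P s) =
    \sum_i \sum_j U i j ^+ 2 * gap i j.
  (* Inserting the identity, written as a constant diagonal in the other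
     eigenbasis, puts the four traces in the form of one double sum. *)
  have trA : \tr (rotated_diag Q a) =
      \tr (rotated_diag Q a *m rotated_diag P (const_mx 1)).
    by rewrite rotated_diag_const1 // mulmx1.
  have trB : \tr (rotated_diag P s) =
      \tr (rotated_diag Q (const_mx 1) *m rotated_diag P s).
    by rewrite rotated_diag_const1 // mul1mx.
  have trAlogA : ln 2 * \tr (rotated_diag Q a *m log2mx (rotated_diag Q a)) =
      \tr (rotated_diag Q (\row_i (a 0 i * ln (a 0 i)))
           *m rotated_diag P (const_mx 1)).
    rewrite rotated_diag_const1 // mulmx1 /log2mx spectral_fun_rotated_diag //.
    rewrite rotated_diagM // -mxtraceZ -rotated_diagZ.
    congr (\tr (rotated_diag _ _)).
    by apply/rowP => i; rewrite !mxE; field; rewrite gt_eqF // ln2_gt0.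
  have trAlogB : ln 2 * \tr (rotated_diag Q a *m log2mx (rotated_diag P s)) =
      \tr (rotated_diag Q a *m rotated_diag P (map_mx (@ln R) s)).
    rewrite /log2mx spectral_fun_rotated_diag // -mxtraceZ scalemxAr.
    rewrite -rotated_diagZ; congr (\tr (_ *m rotated_diag _ _)).
    by apply/rowP => i; rewrite !mxE; field; rewrite gt_eqF // ln2_gt0.
  rewrite /klein_gap mulmxBr raddfB /= mulrBr trAlogA trAlogB trA trB.
  rewrite !mxtrace_rotated_diagM -!sumrB -big_split /=.
  apply: eq_bigr => i _; rewrite -!sumrB -big_split /=; apply: eq_bigr => j _.
  rewrite -/(U i j) /gap; move: (U i j) => u.
  by rewrite !mxE; ring.
have gap_ge0 i j : 0 <= U i j ^+ 2 * gap i j.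
  by rewrite mulr_ge0 ?sqr_ge0 // (scalar_relative_entropy_ge0 (a_ge0 i)).
have sum_ge0 i : 0 <= \sum_j U i j ^+ 2 * gap i j by exact: sumr_ge0.
split; first exact: sumr_ge0.
rewrite eq_sym psumr_eq0 //; apply/allP/eqP => [E|E i _].
  symmetry; apply/(eq_rotated_diagP _ _ _ _ PP QQ) => i j; rewrite -/(U i j).
  have /= := E i (mem_index_enum _).
  rewrite psumr_eq0 // => /allP/(_ j (mem_index_enum _)) /=.
  rewrite mulf_eq0 sqrf_eq0 => /orP[/eqP ->|]; first by rewrite mul0r mulr0.
  rewrite eq_sym (scalar_relative_entropy_ge0 (a_ge0 i) (s_gt0 j)).
  by move=> /eqP ->; rewrite mulrC.
rewrite psumr_eq0 //; apply/allP => j _ /=; rewrite mulf_eq0 sqrf_eq0.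
have := (eq_rotated_diagP _ _ _ _ PP QQ).1 (esym E) i j; rewrite -/(U i j).
have [->//|U0] := eqVneq (U i j) 0.
rewrite mulrC => /(mulIf U0) Es; rewrite eq_sym.
by rewrite (scalar_relative_entropy_ge0 (a_ge0 i) (s_gt0 j)) Es eqxx.
Qed.

Lemma mxtrace_log2mx_expmx A K : K \is symmetricmx ->
  ln 2 * \tr (A *m log2mx (expmx K)) = \tr (A *m K).
Proof. by move=> Ksym; rewrite -mxtraceZ scalemxAr log2mx_expmx. Qed.

Lemma mxtrace_log2mx_sub_expmx A K : K \is symmetricmx ->
  ln 2 * \tr (A *m (log2mx A - log2mx (expmx K))) =
  - (ln 2 * von_neumann_entropy A) - \tr (A *m K).
Proof.
move=> Ksym; rewrite /von_neumann_entropy mulmxBr raddfB /= mulrBr.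
by rewrite mxtrace_log2mx_expmx // mulrN opprK.
Qed.

Lemma klein_gap_expmx A K : K \is symmetricmx ->
  klein_gap A (expmx K) =
  - (ln 2 * von_neumann_entropy A) - \tr (A *m K) - \tr A + \tr (expmx K).
Proof. by move=> Ksym; rewrite /klein_gap mxtrace_log2mx_sub_expmx. Qed.

Lemma von_neumann_entropy_expmx K : K \is symmetricmx ->
  ln 2 * von_neumann_entropy (expmx K) = - \tr (expmx K *m K).
Proof. by move=> Ksym; rewrite mulrN mxtrace_log2mx_expmx. Qed.

Lemma relative_entropy_pdmx rho sigma : pdmx sigma ->
  relative_entropy rho sigma =
  (\tr (rho *m (log2mx rho - log2mx sigma)))%:E.
Proof.
move=> [_ sigma_gt0]; rewrite /relative_entropy asboolT // => u _ v sigma_v.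
have [->|v0] := eqVneq v 0; first by rewrite mulmx0.
by have := sigma_gt0 _ v0; rewrite -mulmxA sigma_v mulmx0 mxE ltxx.
Qed.

End KleinInequality.

(** * Gibbs manifold and moment space *)

Section MomentSpace.
Context {R : realType} {d k : nat} {H : k.-tuple 'M[R]_d}.

Lemma span_tupleP (K : 'M[R]_d) :
  K \in <<H>>%VS <-> exists c : 'I_k -> R, K = \sum_i c i *: tnth H i.
Proof.
split=> [/coord_span ->|[c ->]].
  by exists (fun i => coord H i K); apply: eq_bigr => i _; rewrite -tnth_nth.
by apply: memv_suml => i _; rewrite memvZ // memv_span // mem_tnth.
Qed.

Lemma span_symmetric (K : 'M[R]_d) :
  (forall i : 'I_k, tnth H i \is symmetricmx) ->
  K \in <<H>>%VS -> K \is symmetricmx.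
Proof.
move=> H_symmetric /span_tupleP[c ->]; apply/symmetricmxP; rewrite raddf_sum /=.
by apply: eq_bigr => i _; rewrite linearZ /= (symmetricmxP (H_symmetric i)).
Qed.

Lemma moment_space_span (rho A B K : 'M[R]_d) :
  moment_space H rho A -> moment_space H rho B -> K \in <<H>>%VS ->
  \tr (A *m K) = \tr (B *m K).
Proof.
move=> [_ mA] [_ mB] /span_tupleP[c ->]; rewrite !mulmx_sumr !raddf_sum /=.
apply: eq_bigr => i _; rewrite -!scalemxAr !mxtraceZ.
by rewrite -![\tr (_ *m tnth H i)]mxtrace_mulC mA mB.
Qed.

(** The two Klein gaps between [exp K] and [exp L] are nonnegative and their sum
    is [Tr ((exp K - exp L) (K - L))], which the moment equations annihilate. *)
Lemma gibbs_moment_unique (rho : 'M[R]_d) K L :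
  (forall i : 'I_k, tnth H i \is symmetricmx) ->
  K \in <<H>>%VS -> L \in <<H>>%VS ->
  moment_space H rho (expmx K) -> moment_space H rho (expmx L) ->
  expmx K = expmx L.
Proof.
move=> H_symmetric KH LH mK mL; have Ksym := span_symmetric _ H_symmetric KH.
have Lsym := span_symmetric _ H_symmetric LH.
have psdK := pdmx_psdmx _ (pdmx_expmx _ Ksym).
have psdL := pdmx_psdmx _ (pdmx_expmx _ Lsym).
have gapKL := klein_inequality _ _ psdK (pdmx_expmx _ Lsym).
have gapLK := klein_inequality _ _ psdL (pdmx_expmx _ Ksym).
have gapE M N : M \is symmetricmx -> N \is symmetricmx ->
    klein_gap (expmx M) (expmx N) =
    \tr (expmx M *m M) - \tr (expmx M *m N) - \tr (expmx M) + \tr (expmx N).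
  move=> Msym Nsym; rewrite klein_gap_expmx // von_neumann_entropy_expmx //.
  by rewrite opprK.
have : klein_gap (expmx K) (expmx L) = 0.
  apply/eqP; rewrite eq_le gapKL andbT.
  have := gapLK.1; rewrite !gapE // (moment_space_span _ _ _ _ mK mL KH).
  by rewrite (moment_space_span _ _ _ _ mK mL LH); lra.
by move/esym/eqP; rewrite gapKL => /eqP.
Qed.

End MomentSpace.

Lemma mxtrace_rotated_diag_mul {R : realType} {d} (P : 'M[R]_d) m (A : 'M[R]_d) :
  \tr (rotated_diag P m *m A) = \sum_j m 0 j * (P *m A *m P^T) j j.
Proof.
rewrite /rotated_diag -!mulmxA mxtrace_mulC -!mulmxA.
by apply: eq_bigr => j _; rewrite mul_diag_mx mxE.
Qed.

(** In a common eigenbasis of the [H_i] the moments of [rho] only see its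
    diagonal [r], which is positive, so the classical case applies. *)
Lemma gibbs_moment_exists {R : realType} {d k} {H : k.-tuple 'M[R]_d}
    {rho : 'M[R]_d} :
  (forall i : 'I_k, tnth H i \is symmetricmx) ->
  (forall i j : 'I_k, comm_mx (tnth H i) (tnth H j)) -> pdmx rho ->
  exists2 K, K \in <<H>>%VS & moment_space H rho (expmx K).
Proof.
move=> H_symmetric H_commute [rho_sym rho_gt0].
have [_ /tnthP[i ->] //|_ _ /tnthP[i ->] /tnthP[j ->] //|P PP diagP] :=
  @symmetricmx_codiagonalizable R d H.
have /choice[h hE] : forall i, exists v, tnth H i = rotated_diag P v.
  by move=> i; apply: diagP; exact: mem_tnth.
pose B : 'M[R]_(k, d) := \matrix_i h i.
pose r : 'rV[R]_d := \row_j (P *m rho *m P^T) j j.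
have r_gt0 j : 0 < r 0 j.
  have := rho_gt0 _ (orthogonal_col_neq0 P j PP).
  rewrite trmx_mul trmxK trmx_delta -!mulmxA -rowE.
  by rewrite !mulmxA -colE !mxE.
have [l [lB lE]] := exponential_family_moment_map_surj _ B r r_gt0.
exists (rotated_diag P l).
  have /submxP[t ->] := lB; apply/span_tupleP; exists (t 0).
  rewrite mulmx_sum_row; apply: (big_ind2 (fun v M => rotated_diag P v = M)).
  - apply/matrixP => i j; rewrite rotated_diagE big1 ?mxE // => s _.
    by rewrite mxE mulr0 mul0r.
  - by move=> v M w N <- <-; rewrite rotated_diagD.
  - by move=> i _; rewrite rotated_diagZ rowK hE.
rewrite expmx_rotated_diag //; split=> [|i]; first exact: rotated_diag_symmetric.
have := lE (h i); rewrite -{1}(rowK h i) row_sub => /(_ isT) E.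
rewrite hE !mxtrace_rotated_diag_mul.
transitivity (\sum_j h i 0 j * expR (l 0 j)).
  apply: eq_bigr => j _.
  rewrite /rotated_diag !mulmxA PP mul1mx -mulmxA PP mulmx1.
  by rewrite !mxE eqxx.
by rewrite E; apply: eq_bigr => j _; rewrite mxE.
Qed.

Theorem theorem5p10 (R : realType) (d k : nat) (H : k.-tuple 'M[R]_d)
    (rho : 'M[R]_d)
    (H_symmetric : forall i : 'I_k, tnth H i \is symmetricmx)
    (H_commute : forall i j : 'I_k, comm_mx (tnth H i) (tnth H j))
    (rho_pd : pdmx rho) :
  exists rhostar : 'M[R]_d,
    moment_space H rho `&` gibbs_manifold <<H>>%VS = [set rhostar] /\
    (1%:M \in <<H>>%VS ->
      argmax (@von_neumann_entropy R d) (moment_space H rho `&` @psdmx R d)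
        = [set rhostar] /\
      information_projection (gibbs_manifold <<H>>%VS) rho = [set rhostar]).
Proof.
have [K KH mK] := gibbs_moment_exists H_symmetric H_commute rho_pd.
have Ksym := span_symmetric _ H_symmetric KH.
have pdK := pdmx_expmx _ Ksym.
have psdK := pdmx_psdmx _ pdK.
exists (expmx K); split.
  apply/seteqP; split=> [A [+ [L /= LH LA]]|_ ->]; last by split=> //; exists K.
  rewrite -LA => mL; exact: gibbs_moment_unique H_symmetric LH KH mL mK.
move=> H1.
have mrho : moment_space H rho rho by split=> //; case: rho_pd.
have trM A : moment_space H rho A -> \tr A = \tr (expmx K).
  by move=> mA; have := moment_space_span _ _ _ _ mA mK H1; rewrite !mulmx1.
split.
  have entropy_gap A : moment_space H rho A -> klein_gap A (expmx K) =
      ln 2 * (von_neumann_entropy (expmx K) - von_neumann_entropy A).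
    move=> mA; have := von_neumann_entropy_expmx _ Ksym.
    rewrite klein_gap_expmx // mulrBr => ->.
    by rewrite (trM _ mA) (moment_space_span _ _ _ _ mA mK KH); lra.
  have entropy_max A : moment_space H rho A -> psdmx A ->
      von_neumann_entropy A <= von_neumann_entropy (expmx K)
        ?= iff (A == expmx K).
    move=> mA psdA; have [gap_ge0 gap_eq0] := klein_inequality _ _ psdA pdK.
    rewrite entropy_gap // in gap_ge0 gap_eq0.
    rewrite pmulr_rge0 ?ln2_gt0 // subr_ge0 in gap_ge0; split=> //.
    by rewrite -gap_eq0 [RHS]eq_sym mulf_eq0 (gt_eqF ln2_gt0) subr_eq0 eq_sym.
  apply/seteqP; split=> [A [[mA psdA] A_max]|_ ->].
    have [A_le A_eq] := entropy_max _ mA psdA.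
    by apply/eqP; rewrite -A_eq eq_le A_le A_max.
  by split=> // A [mA psdA]; rewrite entropy_max.
(* The Pythagorean identity: [log (expmx K)] and [log (expmx L)] are multiples
   of [K] and [L], against which [rho] and [expmx K] have equal traces. *)
have rel_entropy_gap L : L \in <<H>>%VS -> \tr (expmx L) = \tr rho ->
    relative_entropy rho (expmx L) =
    (relative_entropy rho (expmx K) +
     ((ln 2)^-1 * klein_gap (expmx K) (expmx L))%:E)%E.
  move=> LH trL; have Lsym := span_symmetric _ H_symmetric LH.
  have pdL := pdmx_expmx _ Lsym.
  rewrite !relative_entropy_pdmx // -EFinD; congr _%:E.
  apply: (mulfI (lt0r_neq0 ln2_gt0)).
  rewrite mulrDr mulVKf ?lt0r_neq0 ?ln2_gt0 //.
  rewrite klein_gap_expmx // von_neumann_entropy_expmx // trL -(trM _ mrho).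
  rewrite [X in _ = X + _](mxtrace_log2mx_sub_expmx _ _ Ksym).
  rewrite [LHS](mxtrace_log2mx_sub_expmx _ _ Lsym).
  by rewrite -(moment_space_span _ _ _ _ mrho mK KH)
             -(moment_space_span _ _ _ _ mrho mK LH); ring.
have trK : \tr (expmx K) = \tr rho by rewrite (trM _ mrho).
have gap_ge0 L : L \in <<H>>%VS ->
    0 <= klein_gap (expmx K) (expmx L) ?= iff (expmx K == expmx L).
  move=> LH; apply: klein_inequality psdK (pdmx_expmx _ _).
  exact: span_symmetric H_symmetric LH.
apply/seteqP; split=> [A [[[L /= LH LA] trA] A_min]|_ ->].
  rewrite -LA in trA A_min *.
  have [gap_ge gap_eq] := gap_ge0 _ LH.
  have := A_min (expmx K); rewrite rel_entropy_gap // => A_le.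
  have {A_le} := A_le (conj (ex_intro2 _ _ K KH erefl) trK).
  rewrite relative_entropy_pdmx // -EFinD lee_fin gerDl.
  rewrite pmulr_rle0 ?invr_gt0 ?ln2_gt0 // => gap_le.
  by apply/eqP; rewrite eq_sym -gap_eq eq_le gap_ge.
split=> [|_ [[L /= LH <-] trL]]; first by split=> //; exists K.
rewrite [leRHS]rel_entropy_gap // relative_entropy_pdmx // -EFinD lee_fin lerDl.
by rewrite mulr_ge0 ?invr_ge0 ?(ltW ln2_gt0) // gap_ge0.
Qed.
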